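(* Consider determined matrix multiplication games $(\mathcal{A},\mathcal{E})$ in which $\mathcal{A}$ and $\mathcal{E}$ are finite sets of matrices with integer elements. (1) The value $V$ of such a game is not computable from the matrices (i.e. from the input $(\mathcal{A},\mathcal{E})$). (2) The value is not computable even knowing a priori that $V\in\{0,1\}$: there is no algorithm which, given finite sets $\mathcal{A},\mathcal{E}$ of integer matrices such that the game $(\mathcal{A},\mathcal{E})$ is determined with value $V\in\{0,1\}$, outputs $V$.
   Context: Matrix multiplication game (MMG) $(\mathcal{A},\mathcal{E})$: here $\mathcal{A}$ is a nonempty set of $(M\times N)$-matrices and $\mathcal{E}$ a nonempty set of $(N\times M)$-matrices. For $i=1,2,\dots$ Adam writes $A_i\in\mathcal{A}$ and then Eve writes $E_i\in\mathcal{E}$. A strategy for Adam is a function $\sigma:(\mathcal{A}\cdot\mathcal{E})^*\to\mathcal{A}$ mapping every finite history to his next move; a strategy for Eve is a function $\tau:(\mathcal{A}\cdot\mathcal{E})^*\cdot\mathcal{A}\to\mathcal{E}$. A pair $(\sigma,\tau)$ determines a unique play $A_1E_1A_2E_2\cdots$, with payoff $P(\sigma,\tau)=\limsup_{k\to\infty}\|A_1E_1\cdots A_kE_k\|^{1/k}$, where $\|\cdot\|$ is the $1$-norm of matrices. Adam minimizes and Eve maximizes the payoff. The game is determined with value $V$ if $\inf_\sigma\sup_\tau P(\sigma,\tau)=\sup_\tau\inf_\sigma P(\sigma,\tau)=V$. Computability of the real-valued function $(\mathcal{A},\mathcal{E})\mapsto V$ means existence of an algorithm which, given $(\mathcal{A},\mathcal{E})$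 (promised to define a determined game) and a rational $\varepsilon>0$, outputs a rational approximation of $V$ within $\varepsilon$. *)

(* Defs.v *)
From HB Require Import structures.
From mathcomp Require Import all_boot all_order all_algebra.
From mathcomp Require Import all_classical all_reals all_analysis.

Set Implicit Arguments.
Unset Strict Implicit.
Unset Printing Implicit Defensive.

Import Order.TTheory GRing.Theory Num.Theory.

Local Open Scope ring_scope.
Local Open Scope classical_set_scope.

Section MatrixMultiplicationGame.
Context {R : realType} {m n : nat}.

(* The operator norm induced by the l^1 norm on column vectors. *)
Definition norm1 {p q : nat} (X : 'M[R]_(p, q)) : R :=
  \big[Num.max/0]_(j < q) \sum_(i < p) `|X i j|.

Variables (A : set 'M[R]_(m, n)) (E : set 'M[R]_(n, m)).

(* A set used as a type denotes the subtype of its elements; a history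
   A_1 E_1 ... A_k E_k is the list of its rounds, oldest round first. *)
Definition history : Type := seq (A * E)%type.

Definition adam_strategy : Type := history -> A.

Definition eve_strategy : Type := history -> A -> E.

Fixpoint play (sigma : adam_strategy) (tau : eve_strategy) (k : nat) : history :=
  if k is k'.+1 then
    let h := play sigma tau k' in rcons h (sigma h, tau h (sigma h))
  else [::].

Definition history_product (h : history) : 'M[R]_m :=
  \prod_(r <- h) (\val r.1 *m \val r.2).

(* The k-th term of the sequence concerns the play after k.+1 rounds, so that
   the exponent is never 1/0; powR is the real power function. *)
Definition payoff (sigma : adam_strategy) (tau : eve_strategy) : \bar R :=
  limn_esup (fun k =>
    (norm1 (history_product (play sigma tau k.+1)) `^ (k.+1%:R)^-1)%:E).

Definition upper_value : \bar R :=
  ereal_inf (range (fun sigma => ereal_sup (range (fun tau => payoff sigma tau)))).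

Definition lower_value : \bar R :=
  ereal_sup (range (fun tau => ereal_inf (range (fun sigma => payoff sigma tau)))).

Definition determined_with_value (V : R) : Prop :=
  upper_value = V%:E /\ lower_value = V%:E.

End MatrixMultiplicationGame.

(* The set of real matrices presented by a list of integer matrices. *)
Definition real_mxset (R : realType) (p q : nat) (s : seq 'M[int]_(p, q)) :
    set 'M[R]_(p, q) :=
  [set map_mx intr X | X in [set` s]].
Arguments real_mxset R {p q} s.

(* Algorithms are partial recursive functions in the sense of Kleene. *)
Inductive recfun : nat -> Type :=
  | RecZero n : recfun n
  | RecSucc : recfun 1
  | RecProj n (i : 'I_n) : recfun n
  | RecComp p n (f : recfun p) (g : 'I_p -> recfun n) : recfun n
  | RecPrim n (f : recfun n) (g : recfun n.+2) : recfun n.+1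
  | RecMin n (f : recfun n.+1) : recfun n.

(* [rec_eval f v y]: the computation of f on v terminates with result y.
   Primitive recursion is on the first argument:
     h(0, v) = f(v),  h(k + 1, v) = g(k, h(k, v), v),
   and minimization looks for the least y with f(y, v) = 0, requiring f to be
   defined at all the smaller arguments. *)
Fixpoint rec_eval n (f : recfun n) : n.-tuple nat -> nat -> Prop :=
  match f in recfun n return n.-tuple nat -> nat -> Prop with
  | RecZero _ => fun _ y => y = 0%N
  | RecSucc => fun v y => y = (thead v).+1
  | RecProj _ i => fun v y => y = tnth v i
  | RecComp p _ f g => fun v y =>
      exists2 w : p.-tuple nat,
        (forall i, rec_eval (g i) v (tnth w i)) & rec_eval f w y
  | RecPrim _ f g => fun v =>
      (fix loop k y : Prop :=
         if k is k'.+1 then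
           exists2 z, loop k' z & rec_eval g [tuple of k' :: z :: behead v] y
         else rec_eval f [tuple of behead v] y) (thead v)
  | RecMin _ f => fun v y =>
      rec_eval f [tuple of y :: v] 0%N /\
      forall x, (x < y)%N -> exists z, rec_eval f [tuple of x :: v] z.+1
  end.

(* Inputs and outputs are coded by natural numbers; [CodeSeq.code] is the
   bijection from lists of natural numbers to natural numbers given by
   code [::] = 0 and code (k :: s) = 2^k (2 code s + 1). *)
Definition code_int (z : int) : nat :=
  match z with Posz k => k.*2 | Negz k => k.*2.+1 end.

Definition code_rat (q : rat) : nat :=
  CodeSeq.code [:: code_int (numq q); code_int (denq q)].

Definition code_mx (p q : nat) (X : 'M[int]_(p, q)) : nat :=
  CodeSeq.code [seq code_int (X i j) | i <- enum 'I_p, j <- enum 'I_q].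

Definition code_mxs (p q : nat) (s : seq 'M[int]_(p, q)) : nat :=
  CodeSeq.code [seq code_mx X | X <- s].

Definition code_game (m n : nat) (A : seq 'M[int]_(m, n))
    (E : seq 'M[int]_(n, m)) : nat :=
  CodeSeq.code [:: m; n; code_mxs A; code_mxs E].

(* Main.v *)
(** With [E = {1}] and [1 \in A] Eve has no choice, and an integer matrix is either
    zero or of norm at least 1: the value is 0 if some product of elements of [A]
    vanishes, and 1 otherwise.  So it suffices that matrix mortality is undecidable.

    A partial recursive function is run by a nondeterministic program on natural
    registers.  Its configuration [x = (1, pc, registers)] is changed linearly by
    each instruction, and each test has the form [l(x) = 0] for a linear form [l].
    Adam may play instructions whose tests fail, but a letter acting on the
    entries of [x^T x] can add the square [l(x)^2] to an error term, so that the
    final letter annihilates the row exactly after an error-free accepting run.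
    The rank-one start letter confines attention to this single row.

    The input [N] of the program only occurs in the start letter.  Taking for [N]
    the code of all the other data of its own game makes the program simulate a
    purported algorithm on that very game and do the opposite. *)

Require Import Defs.
From HB Require Import structures.
From mathcomp Require Import all_boot all_order all_algebra.
From mathcomp Require Import all_classical all_reals all_analysis.
From mathcomp Require Import zify ring lra.

Import Order.TTheory GRing.Theory Num.Theory.

Set Implicit Arguments.
Unset Strict Implicit.
Unset Printing Implicit Defensive.

(** * Register programs *)

Definition store := nat -> nat.

Definition upd (s : store) (i x : nat) : store := fun j => if j == i then x else s j.

Inductive atom :=
  | Zero of nat
  | Copy of nat & nat
  | Succ of nat
  | Eq of nat & nat.

Definition act (a : atom) (s : store) : store :=
  match a with
  | Zero i => upd s i 0
  | Copy i j => upd s i (s j)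
  | Succ i => upd s i (s i).+1
  | Eq _ _ => s
  end.

Definition guard (a : atom) (s : store) : bool :=
  if a is Eq i j then s i == s j else true.

Inductive cmd :=
  | Atom of atom
  | Seq of cmd & cmd
  | Star of cmd.

(** Steps are appended at the end, so induction on a run proves an invariant of the state
    reached. *)
Inductive iterates (T : Type) (r : T -> T -> Prop) (x : T) : T -> Prop :=
  | iterates_refl : iterates r x x
  | iterates_step y z : iterates r x y -> r y z -> iterates r x z.

(** A failed test blocks the run, and [Star] repeats an arbitrary number of times: loops guess their
    length and check it by a later [Eq], without conditional jumps. *)
Fixpoint exec (c : cmd) : store -> store -> Prop :=
  match c with
  | Atom a => fun s t => guard a s /\ t = act a s
  | Seq c1 c2 => fun s t => exists2 u, exec c1 s u & exec c2 u t
  | Star c1 => iterates (exec c1)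
  end.

Lemma iterates_trans (T : Type) (r : T -> T -> Prop) x y z :
  iterates r x y -> iterates r y z -> iterates r x z.
Proof. by move=> rxy; elim=> // u v _ IH; apply: iterates_step. Qed.

Lemma rec_eval_functional n (f : recfun n) v y z :
  rec_eval f v y -> rec_eval f v z -> y = z.
Proof.
elim: f v y z => /=.
- by move=> k v y z -> ->.
- by move=> v y z -> ->.
- by move=> k i v y z -> ->.
- move=> p k f IHf g IHg v y z [w gw fw] [w' gw' fw'].
  have eqw : w = w' by apply: eq_from_tnth => i; apply: IHg (gw i) (gw' i).
  by rewrite -eqw in fw'; apply: IHf fw fw'.
- move=> k f IHf g IHg v; elim: (thead v) => [|j IH] y z; first exact: IHf.
  case=> a la ga [b lb gb]; have eab := IH _ _ la lb.
  by rewrite -eab in gb; apply: IHg ga gb.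
- move=> k f IHf v y z [fy hy] [fz hz].
  (* At the smaller of two distinct minimizers [f] would be both 0 and positive. *)
  case: (ltngtP y z) => // lt.
  + by have [x fx] := hz _ lt; have := IHf _ _ _ fy fx.
  + by have [x fx] := hy _ lt; have := IHf _ _ _ fz fx.
Qed.

(** * Compilation of partial recursive functions into register programs *)

Definition agree (b o : nat) (s t : store) := forall i, i < b -> i != o -> t i = s i.

Fixpoint seqs (l : seq cmd) (c : cmd) : cmd :=
  if l is c1 :: l' then Seq c1 (seqs l' c) else c.

(* [compile f ins o b] reads its arguments in the registers [ins], writes the value
   in the register [o], and uses the registers from [b] on as scratch space.  In the
   case of [RecMin], a value is checked to be positive by guessing it as [1 + k]. *)
Fixpoint compile n (f : recfun n) : n.-tuple nat -> nat -> nat -> cmd :=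
  match f in recfun n return n.-tuple nat -> nat -> nat -> cmd with
  | RecZero _ => fun _ o _ => Atom (Zero o)
  | RecSucc => fun ins o b =>
      seqs [:: Atom (Copy b (thead ins)); Atom (Succ b)] (Atom (Copy o b))
  | RecProj _ i => fun ins o _ => Atom (Copy o (tnth ins i))
  | RecComp p _ f g => fun ins o b =>
      seqs [seq compile (g i) ins (b + i) (b + p) | i <- enum 'I_p]
        (compile f [tuple b + i | i < p] o (b + p))
  | RecPrim _ f g => fun ins o b =>
      seqs [:: compile f [tuple of behead ins] b.+1 b.+3;
               Atom (Zero b);
               Star (seqs [:: compile g [tuple of b :: b.+1 :: behead ins] b.+2 b.+3;
                              Atom (Copy b.+1 b.+2)]
                          (Atom (Succ b)));
               Atom (Eq b (thead ins))]
        (Atom (Copy o b.+1))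
  | RecMin _ f => fun ins o b =>
      seqs [:: Atom (Zero b);
               Star (seqs [:: compile f [tuple of b :: ins] b.+1 b.+3;
                              Atom (Zero b.+2);
                              Atom (Succ b.+2);
                              Star (Atom (Succ b.+2));
                              Atom (Eq b.+1 b.+2)]
                          (Atom (Succ b)));
               compile f [tuple of b :: ins] b.+1 b.+3;
               Atom (Zero b.+2);
               Atom (Eq b.+1 b.+2)]
        (Atom (Copy o b))
  end.


Definition same (b : nat) (s t : store) := forall i, i < b -> t i = s i.

Definition look n (s : store) (ins : n.-tuple nat) := [tuple of map s ins].

(** Soundness concerns every completed run, completeness only some run: a wrong guess must never end
    with a wrong value. *)
Definition implements (r : store -> nat -> Prop) (c : cmd) (o b : nat) :=
  (forall s t, exec c s t -> agree b o s t /\ r s (t o)) /\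
  (forall s y, r s y -> exists2 t, exec c s t & t o = y).

Definition below n (b : nat) (ins : n.-tuple nat) := all (fun i => i < b) ins.

Lemma belowW n b b' (ins : n.-tuple nat) : b <= b' -> below b ins -> below b' ins.
Proof. by move=> leb; apply: sub_all => i /leq_trans; apply. Qed.

Lemma look_same n b s t (ins : n.-tuple nat) :
  same b s t -> below b ins -> look t ins = look s ins.
Proof.
move=> st /allP lt_ins; apply/val_inj/eq_in_map => i /lt_ins; exact: st.
Qed.

Lemma same_trans b s t u : same b s t -> same b t u -> same b s u.
Proof. by move=> st tu i ib; rewrite tu // st. Qed.

Lemma same_upd b s i x : b <= i -> same b s (upd s i x).
Proof. by move=> bi j jb; rewrite /upd; case: eqP => // ji; lia. Qed.

Lemma agree_same b b' o s t : b <= b' -> b <= o -> agree b' o s t -> same b s t.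
Proof. by move=> bb bo st i ib; apply: st; lia. Qed.

(** Each component has its own output register [b + i], and all share the scratch space from [b + p]
    on. In the induction on [l], the clause on indices outside [l] says that results already
    computed survive the later components. *)
Lemma exec_comp p n (g : 'I_p -> recfun n) (ins : n.-tuple nat) b (c : cmd)
    (l : seq 'I_p) :
  (forall i, implements (fun s => rec_eval (g i) (look s ins))
               (compile (g i) ins (b + i) (b + p)) (b + i) (b + p)) ->
  below b ins -> uniq l ->
  let cs := seqs [seq compile (g i) ins (b + i) (b + p) | i <- l] c in
  (forall s t, exec cs s t -> exists2 u, exec c u t &
     [/\ same b s u,
         forall i, i \in l -> rec_eval (g i) (look s ins) (u (b + i)) &
         forall i : 'I_p, i \notin l -> u (b + i) = s (b + i)]) /\
  (forall s (w : 'I_p -> nat), (forall i, rec_eval (g i) (look s ins) (w i)) ->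
     exists u, [/\ forall t, exec c u t -> exec cs s t, same b s u,
         forall i, i \in l -> u (b + i) = w i &
         forall i : 'I_p, i \notin l -> u (b + i) = s (b + i)]).
Proof.
move=> Hg lt_ins; elim: l => [|j l IH] /=.
  by split=> [s t ct | s w gw]; exists s.
case/andP=> jl /IH[IH1 IH2] {IH}; split=> [s t | s w gw].
  case=> s1 /(proj1 (Hg j))[a1 g1] /IH1[u cu [su gu ou]].
  have s1b : same b s s1 by apply: agree_same a1; lia.
  exists u => //; split=> [|i|i].
  - exact: same_trans su.
  - rewrite in_cons; case: (eqVneq i j) => [-> _|ij /= il]; first by rewrite ou.
    by rewrite -(look_same s1b lt_ins); apply: gu.
  - rewrite in_cons negb_or => /andP[ij il]; rewrite ou // a1 ?ltn_add2l //.
    by rewrite eqn_add2l.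
have [s1 e1 y1] := proj2 (Hg j) s _ (gw j).
have [a1 _] := proj1 (Hg j) _ _ e1.
have s1b : same b s s1 by apply: agree_same a1; lia.
have gw1 i : rec_eval (g i) (look s1 ins) (w i) by rewrite (look_same s1b lt_ins).
have [u [cu su gu ou]] := IH2 _ _ gw1; exists u; split=> [t ct||i|i].
- by exists s1 => //; apply: cu.
- exact: same_trans su.
- rewrite in_cons; case: (eqVneq i j) => [-> _|ij /= il]; last exact: gu.
  by rewrite ou.
- rewrite in_cons negb_or => /andP[ij il]; rewrite ou // a1 ?ltn_add2l //.
  by rewrite eqn_add2l.
Qed.

Definition prim_graph (F : nat -> Prop) (G : nat -> nat -> nat -> Prop) :=
  fix loop (k y : nat) : Prop :=
    if k is k'.+1 then exists2 z, loop k' z & G k' z y else F y.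

Lemma rec_eval_prim n (f : recfun n) g v y :
  rec_eval (RecPrim f g) v y =
  prim_graph (rec_eval f [tuple of behead v])
    (fun k z y => rec_eval g [tuple of k :: z :: behead v] y) (thead v) y.
Proof. by []. Qed.

Lemma look_behead n s (ins : n.+1.-tuple nat) :
  look s [tuple of behead ins] = [tuple of behead (look s ins)].
Proof. by apply: val_inj => /=; rewrite behead_map. Qed.

Lemma look_cons n s i (ins : n.-tuple nat) :
  look s [tuple of i :: ins] = [tuple of s i :: look s ins].
Proof. exact: val_inj. Qed.

Lemma thead_look n s (ins : n.+1.-tuple nat) : thead (look s ins) = s (thead ins).
Proof. by rewrite /thead tnth_map. Qed.

Lemma below_behead n b (ins : n.+1.-tuple nat) :
  below b ins -> below b [tuple of behead ins].
Proof. by case/tupleP: ins => i ins /andP[]. Qed.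

Lemma below_tnth n b (ins : n.-tuple nat) i : below b ins -> tnth ins i < b.
Proof. by move/allP; apply; apply: mem_tnth. Qed.

Lemma upd_same s i x : upd s i x i = x.
Proof. by rewrite /upd eqxx. Qed.

Lemma upd_other s i j x : j != i -> upd s i x j = s j.
Proof. by rewrite /upd => /negPf->. Qed.

Lemma iterates_succ i s t : iterates (exec (Atom (Succ i))) s t ->
  s i <= t i /\ forall j, j != i -> t j = s j.
Proof.
elim=> // u v _ [su ou] [_ ->] /=; split=> [|j ji].
  by rewrite upd_same; lia.
by rewrite upd_other // ou.
Qed.

Lemma iterates_succ_ex i s y : s i <= y ->
  exists2 t, iterates (exec (Atom (Succ i))) s t & t i = y.
Proof.
elim: y => [|y IH].
  by rewrite leqn0 => /eqP sy; exists s => //; apply: iterates_refl.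
rewrite leq_eqVlt => /orP[/eqP sy|/IH[t st ty]].
  by exists s => //; apply: iterates_refl.
by exists (upd t i y.+1); [apply: iterates_step st _; rewrite -ty | apply: upd_same].
Qed.

Lemma compile_implements n (f : recfun n) (ins : n.-tuple nat) o b :
  below b ins -> o < b ->
  implements (fun s => rec_eval f (look s ins)) (compile f ins o b) o b.
Proof.
elim: f ins o b => /=.
- move=> k ins o b _ ob; split=> [s t [_ ->] | s y ->] /=.
    by split=> [i _ io|]; rewrite ?upd_same // upd_other.
  by exists (upd s o 0); rewrite ?upd_same.
- move=> ins o b /below_tnth lt_ins ob.
  have tb : thead ins != b by rewrite neq_ltn lt_ins.
  split=> [s t [_ [_ ->] [_ [_ ->] [_ ->]]] | s y ->] /=; rewrite thead_look.
    rewrite !upd_same; split=> [i ib io|//].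
    by rewrite !upd_other //; lia.
  exists (upd (upd (upd s b (s (thead ins))) b (s (thead ins)).+1) o (s (thead ins)).+1);
    last by rewrite upd_same.
  eexists; first by split.
  eexists; first by split.
  by split=> //=; rewrite !upd_same.
- move=> k i ins o b lt_ins ob; split=> [s t [_ ->] | s y ->] /=; rewrite tnth_map.
    by split=> [j _ jo|]; rewrite ?upd_same // upd_other.
  by exists (upd s o (s (tnth ins i))); rewrite ?upd_same.
- move=> p k f IHf g IHg ins o b lt_ins ob.
  have Hg i : implements (fun s => rec_eval (g i) (look s ins))
      (compile (g i) ins (b + i) (b + p)) (b + i) (b + p).
    by apply: IHg; [apply: belowW lt_ins; lia | rewrite ltn_add2l].
  set args := [tuple b + i | i < p].
  have lt_args : below (b + p) args.
    by apply/allP => j /mapP[i _ ->] /=; rewrite ltn_add2l.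
  have Hf := IHf args o (b + p) lt_args (ltn_addr _ ob).
  have [snd cmp] := exec_comp (compile f args o (b + p)) Hg lt_ins (enum_uniq 'I_p).
  split=> [s t /snd[u fu [su gu _]] | s y [w gw fw]].
    have [au fuv] := proj1 Hf _ _ fu; split.
      by move=> i ib io; rewrite au ?su //; lia.
    exists (look u args) => // i; rewrite !tnth_map tnth_ord_tuple.
    by apply: gu; rewrite mem_enum.
  have [u [cu su gu _]] := cmp s _ gw.
  have ew : w = look u args.
    by apply: eq_from_tnth => i; rewrite !tnth_map tnth_ord_tuple gu ?mem_enum.
  rewrite ew in fw; by have [t ft ty] := proj2 Hf u y fw; exists t => //; apply: cu.
- move=> k f IHf g IHg ins o b lt_ins ob.
  set insb := [tuple of behead ins].
  set insg := [tuple of b :: b.+1 :: behead ins].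
  have lt_insb : below b insb by apply: below_behead.
  have Hf := IHf insb b.+1 b.+3 (belowW (leqW (leqW (leqnSn b))) lt_insb) (leqnSn _).
  have lt_insg : below b.+3 insg.
    by rewrite /below /=; apply/and3P; split; [lia|lia|apply: belowW lt_insb; lia].
  have Hg := IHg insg b.+2 b.+3 lt_insg (leqnn _).
  have lt0 : thead ins < b by apply: below_tnth.
  pose F s := rec_eval f [tuple of behead (look s ins)].
  pose G s k z y := rec_eval g [tuple of k :: z :: behead (look s ins)] y.
  have HG s u y : same b s u ->
      rec_eval g (look u insg) y <-> G s (u b) (u b.+1) y.
    move=> su; rewrite /G; suff -> : look u insg =
      [tuple of u b :: u b.+1 :: behead (look s ins)] by [].
    rewrite -(look_same su lt_ins).
    by apply: val_inj => /=; rewrite behead_map.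
  split=> [s t | s y]; rewrite -/(rec_eval (RecPrim f g) (look s ins) _)
      rec_eval_prim -/(F s) -/(G s) thead_look.
    case=> s1 /(proj1 Hf)[a1 f1] [_ [_ ->] [s3 it [_ [/eqP g3 ->] [_ ->]]]].
    rewrite look_behead in f1.
    have s1b : same b s s1 by apply: agree_same a1; lia.
    (* Loop invariant: [b] counts the rounds and [b.+1] holds the value of the recursion at that
       count. *)
    have [s3b p3] : same b s s3 /\ prim_graph (F s) (G s) (s3 b) (s3 b.+1).
      elim: {g3} it => [|u v _ [su pu] [w]].
        split; first by apply: same_trans s1b _; apply: same_upd.
        by rewrite /= upd_same upd_other //; lia.
      move=> /(proj1 Hg)[aw gw] [_ [_ ->] [_ ->]] /=.
      have wb : same b u w by apply: agree_same aw; lia.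
      have eb : w b = u b by apply: aw; lia.
      split.
        apply: same_trans (same_trans su wb) _.
        by apply: same_trans (same_upd _ _ (leqnSn b)) (same_upd _ _ (leqnn b)).
      rewrite upd_same upd_other; last lia.
      rewrite upd_other ?upd_same ?eb; last lia.
      by exists (u b.+1) => //; apply/(HG _ _ _ su).
    split=> [i ib io|] /=; first by rewrite upd_other // s3b.
    by rewrite upd_same -(s3b _ lt0) -g3.
  (* Conversely, a derivation of the value at [j] dictates [j] rounds of the loop. *)
  have steps j z : prim_graph (F s) (G s) j z -> forall s2, same b s s2 ->
      s2 b = 0 -> F s (s2 b.+1) -> exists s3, [/\ iterates (exec
       (seqs [:: compile g insg b.+2 b.+3; Atom (Copy b.+1 b.+2)] (Atom (Succ b)))) s2 s3,
       same b s s3, s3 b = j & s3 b.+1 = z].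
    move=> pj s2 s2b s20 F2; elim: j z pj => [|j IH] z /=.
      move=> Fz; exists s2; split=> //; first exact: iterates_refl.
      exact: rec_eval_functional F2 Fz.
    case=> x /IH[s3 [it s3b s3j s3x]] gz.
    have /(proj2 Hg)[w gw wz] : rec_eval g (look s3 insg) z.
      by apply/(HG _ _ _ s3b); rewrite s3j s3x.
    have [aw _] := proj1 Hg _ _ gw.
    have wb : same b s3 w by apply: agree_same aw; lia.
    have eb : w b = s3 b by apply: aw; lia.
    exists (upd (upd w b.+1 (w b.+2)) b j.+1); split; last 2 first.
    - by rewrite upd_same.
    - by rewrite upd_other ?upd_same //; lia.
    - apply: iterates_step it _; exists w => //; eexists; first by split.
      by split=> //=; rewrite upd_other ?eb ?s3j //; lia.
    - apply: same_trans (same_trans s3b wb) _.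
      by apply: same_trans (same_upd _ _ (leqnSn b)) (same_upd _ _ (leqnn b)).
  move=> py.
  (* A value at any count contains a value at count 0, which the first command has to compute. *)
  have [z /= Fz] : exists z, F s z.
    by elim: (s (thead ins)) y py => [|j IH] y /=; [exists y | case=> z /IH].
  have := Fz; rewrite /F -look_behead => /(proj2 Hf)[s1 f1 s1z].
  have [a1 _] := proj1 Hf _ _ f1.
  have s1b : same b s s1 by apply: agree_same a1; lia.
  have [] := steps _ _ py (upd s1 b 0).
  - by apply: same_trans s1b _; apply: same_upd.
  - by rewrite upd_same.
  - by rewrite upd_other ?s1z //; lia.
  move=> s3 [it s3b s3k s3y].
  exists (upd s3 o (s3 b.+1)); last by rewrite upd_same.
  exists s1 => //; eexists; first by split.
  exists s3 => //; exists s3; first by split=> //=; rewrite s3k s3b.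
  by split.
- move=> k f IHf ins o b lt_ins ob.
  set insf := [tuple of b :: ins].
  have lt_insf : below b.+3 insf.
    by rewrite /below /=; apply/andP; split; [lia | apply: belowW lt_ins; lia].
  have Hf := IHf insf b.+1 b.+3 lt_insf (leqnSn _).
  have HF s u x : same b s u ->
      rec_eval f (look u insf) x <-> rec_eval f [tuple of u b :: look s ins] x.
    by move=> su; rewrite look_cons (look_same su lt_ins).
  have sub s u v : same b s u -> exec (compile f insf b.+1 b.+3) u v ->
      [/\ same b s v, v b = u b & rec_eval f [tuple of u b :: look s ins] (v b.+1)].
    move=> su /(proj1 Hf)[av fv]; have vb : same b u v by apply: agree_same av; lia.
    split; first exact: same_trans vb.
      by apply: av; lia.
    exact/(HF _ _ _ su).
  split=> [s t | s y].
    case=> _ [_ ->] [s3 it [s4 f4 [_ [_ ->] [_ [/= /eqP z4 ->] [_ ->]]]]].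
    (* Loop invariant: [f] is positive at all arguments below the counter. The [Eq] of each round
       forces this, as [b.+2] then holds a guess of at least 1. *)
    have [s3b p3] : same b s s3 /\ forall x, x < s3 b ->
        exists z, rec_eval f [tuple of x :: look s ins] z.+1.
      elim: {f4} it => [|u v _ [su pu] [w1]].
        by split=> /=; [apply: same_upd | rewrite upd_same].
      move=> /(sub _ _ _ su)[w1b e1 fw].
      case=> _ [_ ->] [_ [_ ->] [w3 /iterates_succ[ge3 o3]]].
      rewrite /= upd_same in ge3 => -[_ [/= /eqP e3 ->] [_ ->]] /=.
      have w3E i : i != b.+2 -> w3 i = w1 i by move=> ib; rewrite o3 //= !upd_other.
      split.
        apply: same_trans (same_upd _ _ (leqnn b)).
        by apply: same_trans w1b _ => i ib; apply: w3E; lia.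
      move=> x; rewrite upd_same w3E ?e1; last lia.
      rewrite ltnS leq_eqVlt => /orP[/eqP->|/pu //].
      rewrite w3E in e3; last lia.
      by exists (w1 b.+1).-1; rewrite prednK // e3; lia.
    have [s4b e4 f4'] := sub _ _ _ s3b f4.
    rewrite upd_same upd_other in z4; last lia.
    rewrite z4 in f4'; split=> [i ib io|] /=.
      by rewrite !upd_other ?s4b //; lia.
    by rewrite upd_same upd_other ?e4 //; lia.
  case=> fy hy.
  have runf u x : same b s u -> rec_eval f [tuple of u b :: look s ins] x ->
      exists v, [/\ exec (compile f insf b.+1 b.+3) u v, same b s v, v b = u b & v b.+1 = x].
    move=> su /(HF _ _ _ su)/(proj2 Hf)[v fv vx].
    by have [vb eb _] := sub _ _ _ su fv; exists v.
  have [s3 [it s3b s3y]] : exists s3, [/\ iterates (exec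
      (seqs [:: compile f insf b.+1 b.+3; Atom (Zero b.+2); Atom (Succ b.+2);
             Star (Atom (Succ b.+2)); Atom (Eq b.+1 b.+2)] (Atom (Succ b))))
      (upd s b 0) s3, same b s s3 & s3 b = y].
    elim: {fy} y hy => [|y IH] hy.
      exists (upd s b 0); split; first exact: iterates_refl.
        exact: same_upd.
      by rewrite upd_same.
    have [x xy|s3 [it s3b s3y]] := IH; first by apply: hy; lia.
    have [z fz] := hy y (leqnn _); rewrite -s3y in fz.
    have [v [fv vb ev ez]] := runf _ _ s3b fz.
    pose v1 := upd (upd v b.+2 0) b.+2 1.
    (* The right guess is the actual positive value [z.+1] of [f]. *)
    have [v2 it2 v2z] := @iterates_succ_ex b.+2 v1 z.+1 ltac:(by rewrite /v1 upd_same).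
    have [_ o2] := iterates_succ it2.
    have v2E i : i != b.+2 -> v2 i = v i by move=> ib; rewrite o2 // /v1 !upd_other.
    exists (upd v2 b y.+1); split; last by rewrite upd_same.
      apply: iterates_step it _; exists v => //.
      eexists; first by split.
      eexists; first by split.
      exists v2; first by rewrite /= upd_same.
      exists v2; first by split=> //=; rewrite v2z v2E ?ez //; lia.
      by split=> //=; rewrite v2E ?ev ?s3y //; lia.
    apply: same_trans (same_upd _ _ (leqnn b)).
    by apply: same_trans vb _ => i ib; apply: v2E; lia.
  rewrite -s3y in fy; have [v [fv vb ev ez]] := runf _ _ s3b fy.
  pose v1 := upd v b.+2 0.
  exists (upd v1 o (v1 b)); last by rewrite upd_same /v1 upd_other ?ev //; lia.
  eexists; first by split.
  exists s3 => //; exists v => //; exists v1; first by split.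
  exists v1; last by split.
  by split=> //=; rewrite /v1 upd_same upd_other ?ez //; lia.
Qed.

(** * Total computable functions *)

Definition computable n (F : n.-tuple nat -> nat) :=
  exists f : recfun n, forall v, rec_eval f v (F v).

Lemma computable_ext n (F G : n.-tuple nat -> nat) :
  F =1 G -> computable F -> computable G.
Proof. by move=> FG [f fF]; exists f => v; rewrite -FG. Qed.

Lemma computable_proj n (i : 'I_n) : computable (fun v => tnth v i).
Proof. by exists (RecProj i). Qed.

Lemma computable_comp p n (F : p.-tuple nat -> nat) (G : 'I_p -> n.-tuple nat -> nat) :
  computable F -> (forall i, computable (G i)) ->
  computable (fun v => F [tuple G i v | i < p]).
Proof.
move=> [f fF] /choice[g gG]; exists (RecComp f g) => v /=.
by exists [tuple G i v | i < p] => [i|]; rewrite ?tnth_mktuple.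
Qed.

Lemma computable_subst m n (F : n.-tuple nat -> nat) (sigma : 'I_n -> 'I_m) :
  computable F -> computable (fun v => F [tuple tnth v (sigma i) | i < n]).
Proof.
by move=> cF; apply: (computable_comp cF) => i; apply: computable_proj.
Qed.

Lemma computable_succ n (F : n.-tuple nat -> nat) :
  computable F -> computable (fun v => (F v).+1).
Proof.
move=> [f fF]; exists (RecComp RecSucc (fun=> f)) => v.
by exists [tuple F v] => // i; rewrite ord1.
Qed.

Lemma computable_const n k : computable (fun _ : n.-tuple nat => k).
Proof.
elim: k => [|k IH]; first by exists (RecZero n).
exact: (computable_succ IH).
Qed.

Lemma computable_iter n (B F : n.-tuple nat -> nat) (G : n.+2.-tuple nat -> nat) :
  computable B -> computable F -> computable G ->
  computable (fun v => nat_rect (fun=> nat) (F v)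
                (fun k z => G [tuple of k :: z :: v]) (B v)).
Proof.
move=> [b bB] [f fF] [g gG].
(* [RecPrim] recurses on the first argument, so [B v] is put in front of [v]. *)
pose args (i : 'I_n.+1) := if unlift ord0 i is Some j then RecProj j else b.
exists (RecComp (RecPrim f g) args) => v.
exists [tuple of B v :: v].
  move=> i; rewrite /args; case: unliftP => [j ->|->] /=; last exact: bB.
  by rewrite !(tnth_nth 0) /=.
rewrite rec_eval_prim theadE; have -> : [tuple of behead [tuple of B v :: v]] = v.
  exact: val_inj.
set Gr := (X in prim_graph _ X _ _).
have grP k z : Gr k z (G [tuple of k :: z :: v]).
  rewrite /Gr; set w := (X in rec_eval g X _).
  by have -> : w = [tuple of k :: z :: v]; [apply: val_inj | apply: gG].
elim: (B v) Gr grP => [|k IH] Gr grP /=; first exact: fF.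
by eexists; [apply: IH | apply: grP].
Qed.

Lemma computable_shift2 n (F : n.-tuple nat -> nat) : computable F ->
  exists2 G : n.+2.-tuple nat -> nat, computable G &
    forall k z (v : n.-tuple nat), G [tuple of k :: z :: v] = F v.
Proof.
move=> cF; exists (fun w => F [tuple tnth w (lift ord0 (lift ord0 i)) | i < n]).
  exact: computable_subst.
move=> k z v; congr F; apply: eq_from_tnth => i.
by rewrite tnth_mktuple !(tnth_nth 0).
Qed.

Lemma computable_add n (F G : n.-tuple nat -> nat) :
  computable F -> computable G -> computable (fun v => F v + G v).
Proof.
move=> cF cG.
have := computable_iter cF cG (computable_succ (computable_proj (lift ord0 ord0))).
apply: computable_ext => v; elim: (F v) => //= k.
by rewrite (tnth_nth 0) /= => ->.
Qed.

Lemma computable_mul n (F G : n.-tuple nat -> nat) :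
  computable F -> computable G -> computable (fun v => F v * G v).
Proof.
move=> cF /computable_shift2[H cH HG].
have := computable_iter cF (computable_const n 0)
  (computable_add cH (computable_proj (lift ord0 ord0))).
apply: computable_ext => v; elim: (F v) => //= k.
by rewrite HG (tnth_nth 0) /= => ->; rewrite mulSn.
Qed.

Lemma computable_exp2 n (F : n.-tuple nat -> nat) :
  computable F -> computable (fun v => 2 ^ F v).
Proof.
move=> cF; have cp := computable_proj (n := n.+2) (lift ord0 ord0).
have := computable_iter cF (computable_const n 1) (computable_add cp cp).
apply: computable_ext => v; elim: (F v) => //= k.
by rewrite (tnth_nth 0) /= => ->; rewrite expnS mul2n addnn.
Qed.

Lemma computable_double n (F : n.-tuple nat -> nat) :
  computable F -> computable (fun v => (F v).*2).
Proof.
by move=> cF; apply: computable_ext (computable_add cF cF) => v; rewrite addnn.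
Qed.

(** Only encoding has to be computable: a program decodes by guessing the components and comparing
    codes. *)
Definition pcons (k r : nat) : nat := 2 ^ k * r.*2.+1.

Lemma code_cons k s : CodeSeq.code (k :: s) = pcons k (CodeSeq.code s).
Proof. by []. Qed.

Lemma computable_pcons n (F G : n.-tuple nat -> nat) :
  computable F -> computable G -> computable (fun v => pcons (F v) (G v)).
Proof.
move=> cF cG; apply: computable_mul; first exact: computable_exp2.
exact/computable_succ/computable_double.
Qed.

(** * Predicates accepted by programs *)

Definition env n (s : store) : n.-tuple nat := [tuple s i | i < n].

(** The input registers have to survive a run, so that a second program can be run on the same
    input. *)
Definition recognizable n (R : n.-tuple nat -> Prop) :=
  exists c, forall s, (R (env n s) <-> exists t, exec c s t) /\
                      (forall t, exec c s t -> same n s t).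

Lemma env_same n s t : same n s t -> env n t = env n s.
Proof. by move=> st; apply: eq_from_tnth => i; rewrite !tnth_mktuple st. Qed.

Lemma recognizable_ext n (R Q : n.-tuple nat -> Prop) :
  (forall v, R v <-> Q v) -> recognizable R -> recognizable Q.
Proof. by move=> RQ [c cR]; exists c => s; rewrite -RQ. Qed.

Lemma recognizable_eval n (f : recfun n) (G : n.-tuple nat -> nat) :
  computable G -> recognizable (fun v => rec_eval f v (G v)).
Proof.
move=> [g gG]; pose ins := [tuple val i | i < n].
have lookE s : look s ins = env n s.
  by apply: eq_from_tnth => i; rewrite !(tnth_map, tnth_ord_tuple).
have lt_ins : below n ins by apply/allP => j /mapP[i _ ->] /=.
have Hf := compile_implements f (belowW (leqW (leqnSn n)) lt_ins) (leqnSn n.+1).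
have Hg := compile_implements g (belowW (leqW (leqnSn n)) lt_ins) (leqnn n.+2).
exists (seqs [:: compile f ins n n.+2; compile g ins n.+1 n.+2] (Atom (Eq n n.+1))).
have sub s t : exec (seqs [:: compile f ins n n.+2; compile g ins n.+1 n.+2]
    (Atom (Eq n n.+1))) s t -> same n s t /\ rec_eval f (env n s) (G (env n s)).
  case=> u /(proj1 Hf)[au fu] [w /(proj1 Hg)[aw gw] [/eqP e ->]] /=.
  have su : same n s u by apply: agree_same au; lia.
  have uw : same n u w by apply: agree_same aw; lia.
  split; first exact: same_trans uw.
  rewrite lookE in fu; rewrite lookE (env_same su) in gw.
  rewrite -(rec_eval_functional gw (gG _)) -e aw //; lia.
move=> s; split=> [|t /sub[]//]; split=> [fy|[t /sub[]//]].
have := fy; rewrite -lookE => /(proj2 Hf)[u fu uy].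
have [au _] := proj1 Hf _ _ fu.
have su : same n s u by apply: agree_same au; lia.
have := gG (env n s); rewrite -(env_same su) -lookE => /(proj2 Hg)[w gw wy].
have [aw _] := proj1 Hg _ _ gw.
exists w; exists u => //; exists w => //; split=> //=.
by rewrite wy lookE (env_same su) -lookE -uy; apply/eqP/aw; lia.
Qed.

Lemma recognizable_eq n (F G : n.-tuple nat -> nat) :
  computable F -> computable G -> recognizable (fun v => F v = G v).
Proof.
move=> [f fF] cG; apply: recognizable_ext (recognizable_eval f cG) => v.
by split=> [fG|<-] //; apply: rec_eval_functional fG.
Qed.

Lemma recognizable_and n (R Q : n.-tuple nat -> Prop) :
  recognizable R -> recognizable Q -> recognizable (fun v => R v /\ Q v).
Proof.
move=> [c cR] [d dQ]; exists (Seq c d) => s; split; first split.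
- case=> Rs Qs; have [t ct] := proj1 (proj1 (cR s)) Rs.
  have st := proj2 (cR s) _ ct; rewrite -(env_same st) in Qs.
  by have [u du] := proj1 (proj1 (dQ t)) Qs; exists u; exists t.
- case=> u [t ct du]; split; first by apply/(proj1 (cR s)); exists t.
  by rewrite -(env_same (proj2 (cR s) _ ct)); apply/(proj1 (dQ t)); exists u.
- move=> u [t ct du]; exact: same_trans (proj2 (cR s) _ ct) (proj2 (dQ t) _ du).
Qed.

(** The witness is guessed in register [n], which becomes the last input of the inner program;
    clearing it first makes every natural number a possible guess. *)
Lemma recognizable_ex n (R : n.+1.-tuple nat -> Prop) :
  recognizable R -> recognizable (fun v => exists x, R [tuple of rcons v x]).
Proof.
move=> [c cR]; exists (seqs [:: Atom (Zero n); Star (Atom (Succ n))] c) => s.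
have envS t : same n s t -> env n.+1 t = [tuple of rcons (env n s) (t n)].
  move=> st; apply: eq_from_tnth => i; rewrite tnth_mktuple (tnth_nth 0) /=.
  have sz : size (env n s) = n by rewrite size_tuple.
  rewrite nth_rcons sz; case: ltngtP => [lt_in|lt_in|->] //.
    by rewrite -(tnth_nth 0 (env n s) (Ordinal lt_in)) tnth_mktuple st.
  by have := ltn_ord i; lia.
have guess t : iterates (exec (Atom (Succ n))) (upd s n 0) t -> same n s t.
  by move=> /iterates_succ[_ ot] i lt_in; rewrite ot ?upd_other //; lia.
split; first split.
- case=> x Rx.
  have [t it tx] := @iterates_succ_ex n (upd s n 0) x ltac:(by rewrite upd_same).
  have st := guess _ it; rewrite -tx -envS // in Rx.
  have [u cu] := proj1 (proj1 (cR t)) Rx; exists u.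
  by eexists; [split | exists t].
- case=> u [_ [_ ->] [t it cu]]; exists (t n); rewrite -envS; last exact: guess.
  by apply/(proj1 (cR t)); exists u.
- move=> u [_ [_ ->] [t it cu]]; apply: same_trans (guess _ it) _ => i lt_in.
  by apply: (proj2 (cR t) _ cu); lia.
Qed.

(** * Control graphs of programs *)

HB.instance Definition _ := gen_eqMixin atom.

Definition edge := (nat * atom * nat)%type.

Definition step (es : seq edge) (x y : nat * store) :=
  exists a, [/\ (x.1, a, y.1) \in es, guard a x.2 & y.2 = act a x.2].

(** A test that always succeeds serves as an unconditional jump. *)
Definition skip := Eq 0 0.

Fixpoint cmd_size (c : cmd) : nat :=
  match c with
  | Atom _ => 1
  | Seq c1 c2 => cmd_size c1 + cmd_size c2
  | Star c1 => (cmd_size c1).+2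
  end.

(* The control graph of [c], entered at [b] and left at [b + cmd_size c]. *)
Fixpoint edges (c : cmd) (b : nat) : seq edge :=
  match c with
  | Atom a => [:: (b, a, b.+1)]
  | Seq c1 c2 => edges c1 b ++ edges c2 (b + cmd_size c1)
  | Star c1 => [:: (b, skip, b.+1), (b.+1 + cmd_size c1, skip, b),
                   (b, skip, b + (cmd_size c1).+2) & edges c1 b.+1]
  end.

Lemma cmd_size_gt0 c : 0 < cmd_size c.
Proof. by elim: c => //= c1 IH1 c2 _; rewrite addn_gt0 IH1. Qed.

Lemma edges_range c b p a q : (p, a, q) \in edges c b ->
  b <= p < b + cmd_size c /\ b <= q <= b + cmd_size c.
Proof.
elim: c b => /= [a'|c1 IH1 c2 IH2|c1 IH1] b.
- by rewrite inE => /eqP[-> _ ->]; lia.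
- by rewrite mem_cat => /orP[/IH1|/IH2]; lia.
- rewrite !in_cons => /or4P[/eqP[-> _ ->]|/eqP[-> _ ->]|/eqP[-> _ ->]|/IH1]; lia.
Qed.

Lemma steps_sub es es' x y : {subset es <= es'} ->
  iterates (step es) x y -> iterates (step es') x y.
Proof.
move=> sub; elim=> [|u v _ IH [a [/sub ae ga e]]]; first exact: iterates_refl.
by apply: iterates_step IH _; exists a.
Qed.

Lemma edges_of_exec c b s t : exec c s t ->
  iterates (step (edges c b)) (b, s) (b + cmd_size c, t).
Proof.
elim: c b s t => /= [a|c1 IH1 c2 IH2|c1 IH1] b s t.
- case=> ga ->; apply: iterates_step (iterates_refl _ _) _.
  by exists a; rewrite addn1 inE eqxx.
- case=> u /(IH1 b) e1 /(IH2 (b + cmd_size c1)); rewrite -addnA => e2.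
  have s1 : {subset edges c1 b <= edges c1 b ++ edges c2 (b + cmd_size c1)}.
    by move=> e; rewrite mem_cat => ->.
  have s2 : {subset edges c2 (b + cmd_size c1) <= edges c1 b ++ edges c2 (b + cmd_size c1)}.
    by move=> e; rewrite mem_cat orbC => ->.
  exact: iterates_trans (steps_sub s1 e1) (steps_sub s2 e2).
- set es := edges (Star c1) b => it.
  have e0 u : step es (b, u) (b.+1, u) by exists skip; split; rewrite //= !inE eqxx.
  have e1 u : step es (b.+1 + cmd_size c1, u) (b, u).
    by exists skip; split; rewrite //= !inE eqxx orbT.
  have e2 u : step es (b, u) (b + (cmd_size c1).+2, u).
    by exists skip; split; rewrite //= !inE eqxx !orbT.
  apply: iterates_step (e2 t); elim: it => [|u v _ IH /(IH1 b.+1) uv].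
    exact: iterates_refl.
  apply: iterates_step (e1 v); apply: iterates_trans (steps_sub _ uv).
    exact: iterates_step (e0 u).
  by move=> e; rewrite /es /= !inE => ->; rewrite !orbT.
Qed.

(** Subprograms share labels only at their interfaces, so the current label tells which part of the
    program a run has reached. *)
Lemma exec_of_edges c b s t :
  iterates (step (edges c b)) (b, s) (b + cmd_size c, t) -> exec c s t.
Proof.
elim: c b s t => [a|c1 IH1 c2 IH2|c1 IH1] b s t.
- have inv y : iterates (step (edges (Atom a) b)) (b, s) y ->
      y = (b, s) \/ guard a s /\ y = (b.+1, act a s).
    elim=> [|u v _ IH]; [by left | case: v => q v].
    case=> a' [/=]; rewrite inE => /eqP[eb -> ->].
    by case: IH eb => [->|[_ ->]] /= eb ga ->; [right | lia].
  by move=> /inv[[]|[ga [_ ->]]] //=; lia.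
- have l2 := cmd_size_gt0 c2.
  (* Below [b + cmd_size c1] the run is inside [c1]; from there on it has completed [c1] and cannot
     return. *)
  have inv y : iterates (step (edges (Seq c1 c2) b)) (b, s) y ->
      (y.1 < b + cmd_size c1 /\ iterates (step (edges c1 b)) (b, s) y) \/
      (exists2 u, exec c1 s u &
         iterates (step (edges c2 (b + cmd_size c1))) (b + cmd_size c1, u) y).
    elim=> [|x z _ IH].
      by left; split; [have := cmd_size_gt0 c1; rewrite /=; lia | apply: iterates_refl].
    case=> a [xe ga za]; rewrite /= mem_cat in xe; case/orP: xe => xe.
      have [xr zr] := edges_range xe.
      case: IH => [[ltx it]|[u _ it]].
        have it' : iterates (step (edges c1 b)) (b, s) z.
          by apply: iterates_step it _; exists a.
        case: (ltnP z.1 (b + cmd_size c1)) => [ltz|gez]; [by left | right].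
        case: z {xe ga za zr} it' gez (zr) => q v /= it' gez zr.
        have eq : q = b + cmd_size c1 by lia.
        rewrite eq in it' *; exists v; [exact: IH1 it' | exact: iterates_refl].
      have : b + cmd_size c1 <= x.1.
        by elim: it {xr ga za xe} => //= y' z' _ _ [a' [/edges_range]]; lia.
      by lia.
    have [xr zr] := edges_range xe.
    case: IH => [[ltx _]|[u eu it]]; first by lia.
    by right; exists u => //; apply: iterates_step it _; exists a.
  case/inv => [[] /=|[u eu]]; first by lia.
  by rewrite /= addnA => /IH2; exists u.
(* The cases are the loop head, the body, and the exit label, which no edge leaves. *)
- have inv y : iterates (step (edges (Star c1) b)) (b, s) y ->
      [\/ y.1 = b /\ exec (Star c1) s y.2,
          b < y.1 <= b.+1 + cmd_size c1 /\ (exists2 u, exec (Star c1) s u &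
             iterates (step (edges c1 b.+1)) (b.+1, u) y) |
          y.1 = b + (cmd_size c1).+2 /\ exec (Star c1) s y.2].
    elim=> [|[p u] [q v] _ IH]; first by constructor 1; split; last exact: iterates_refl.
    case=> a [/=]; rewrite !in_cons.
    case/or4P=> [/eqP[ep -> ->]|/eqP[ep -> ->]|/eqP[ep -> ->]|pe] ga /=.
    + move=> ->; constructor 2; split; first by lia.
      exists u; last exact: iterates_refl.
      by case: IH => /= [[_ //]|[]|[]]; lia.
    + move=> ->; constructor 1; split=> //.
      case: IH => /= [[]|[_ [w sw it]]|[]]; rewrite ?ep; try lia.
      by apply: iterates_step sw _; apply: (IH1 b.+1); rewrite -ep.
    + move=> ->; constructor 3; split=> //.
      by case: IH => /= [[_ //]|[]|[]]; lia.
    + move=> ev; have [pr qr] := edges_range pe; constructor 2; split; first by lia.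
      case: IH => /= [[]|[_ [w sw it]]|[]]; try lia.
      by exists w => //; apply: iterates_step it _; exists a.
  by case/inv => /= [[]|[]|[_ //]]; lia.
Qed.

Local Open Scope ring_scope.

(** * Matrix mortality *)

Lemma mul_rV_linear (K : comNzRingType) m n (f : 'rV[K]_m -> 'rV[K]_n) :
  linear f -> forall u, u *m lin1_mx f = f u.
Proof.
move=> lf u.
pose F := GRing.isLinear.Build K 'rV[K]_m 'rV[K]_n *:%R f lf.
pose g : {linear 'rV[K]_m -> 'rV[K]_n} := HB.pack f F.
exact: (mul_rV_lin1 g).
Qed.

Lemma prod_mx_rcons (K : pzSemiRingType) D (l : seq 'M[K]_D) X :
  \prod_(Y <- rcons l X) Y = (\prod_(Y <- l) Y) *m X.
Proof. by rewrite big_rcons. Qed.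

(** * The row space and its letters *)

Section Arena.
Variable d : nat.
Local Notation dim := (4 + d * d)%N.

(** A row is a pair [(h, X)]: [h] has the error term in entry 0 and the unread input in entries 1 to
    3, and [X] is meant to be [x^T x]. The matrix represents [F] once [F] is linear, as in
    [cfg_letter]. *)
Definition letter (F : 'rV[int]_4 -> 'M[int]_d -> 'rV[int]_4 * 'M[int]_d) : 'M[int]_dim :=
  lin1_mx (fun y : 'rV_dim =>
    row_mx (F (lsubmx y) (vec_mx (rsubmx y))).1
           (mxvec (F (lsubmx y) (vec_mx (rsubmx y))).2)).

Definition cfg (h : 'rV[int]_4) (X : 'M[int]_d) : 'rV[int]_dim := row_mx h (mxvec X).

Lemma cfg_letter F h X :
  (forall c h h' X X', F (c *: h + h') (c *: X + X') =
     (c *: (F h X).1 + (F h' X').1, c *: (F h X).2 + (F h' X').2)) ->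
  cfg h X *m letter F = cfg (F h X).1 (F h X).2.
Proof.
move=> lF; rewrite mul_rV_linear /cfg ?row_mxKl ?row_mxKr ?mxvecK //.
move=> c u v; rewrite !linearP /= lF /= !linearP /=.
by rewrite scale_row_mx add_row_mx.
Qed.

Definition row4 (a b c e : int) : 'rV[int]_4 := \row_k nth 0 [:: a; b; c; e] k.

Lemma row4D a b c e a' b' c' e' :
  row4 a b c e + row4 a' b' c' e' = row4 (a + a') (b + b') (c + c') (e + e').
Proof.
by apply/rowP => k; rewrite !mxE; case: k => [[|[|[|[|k]]]] lt_k].
Qed.

Lemma row4Z x a b c e : x *: row4 a b c e = row4 (x * a) (x * b) (x * c) (x * e).
Proof.
by apply/rowP => k; rewrite !mxE; case: k => [[|[|[|[|k]]]] lt_k].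
Qed.

Lemma row4_0 : row4 0 0 0 0 = 0.
Proof. by rewrite -[RHS](scale0r (row4 0 0 0 0)) row4Z !mul0r. Qed.

Lemma cfg0 : cfg 0 0 = 0.
Proof. by rewrite /cfg linear0 row_mx0. Qed.

Lemma cfg00 a b c e X : cfg (row4 a b c e) X 0 0 = a.
Proof.
by rewrite (_ : 0 = lshift _ (0 : 'I_4)) ?row_mxEl ?mxE //; apply: val_inj.
Qed.

(** Of rank at most one: every row is sent to a multiple of [w], the factor being its error
    entry. *)
Definition start (w : 'rV[int]_dim) : 'M[int]_dim := delta_mx (0 : 'I_dim) (0 : 'I_1) *m w.

Lemma mul_start y w : y *m start w = y 0 0 *: w.
Proof.
rewrite /start mulmxA; have -> : y *m delta_mx 0 0 = (y 0 0)%:M :> 'M[int]_1.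
  by rewrite -colE; apply/matrixP => i j; rewrite !ord1 !mxE eqxx.
by rewrite mul_scalar_mx.
Qed.

End Arena.

(** * Simulation of program steps by integer matrices *)

Section Simulation.
Variable K : nat.
Local Notation d := K.+2.

(** The constant coordinate 1 makes affine changes, such as the successor, linear. *)
Definition coords (p : nat) (s : store) (k : nat) : int :=
  match k with 0 => 1 | 1 => p%:Z | k'.+2 => (s k')%:Z end.

Definition enc p s : 'rV[int]_d := \row_k coords p s k.

(** Squares of linear forms in [x] are linear in this matrix. *)
Definition gram (x : 'rV[int]_d) : 'M[int]_d := x^T *m x.

Definition next_coord (q : nat) (a : atom) (x : nat -> int) (k : nat) : int :=
  match k with
  | 0 => x 0%N
  | 1 => q%:Z * x 0%N
  | k'.+2 =>
    match a with
    | Zero i => if k' == i then 0 else x k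
    | Copy i j => if k' == i then x j.+2 else x k
    | Succ i => if k' == i then x k + x 0%N else x k
    | Eq _ _ => x k
    end
  end.

Definition fits (a : atom) : bool :=
  match a with
  | Zero i | Succ i => (i < K)%N
  | Copy i j | Eq i j => (i < K)%N && (j < K)%N
  end.

Definition update_mx q a : 'M[int]_d :=
  lin1_mx (fun x : 'rV_d => \row_(k < d) next_coord q a (fun r => x 0 (inord r)) k).

Lemma enc_update q p a s : fits a -> enc p s *m update_mx q a = enc q (act a s).
Proof.
move=> fa; rewrite mul_rV_linear; last first.
  move=> c x y; apply/rowP => k; rewrite !mxE.
  case: (val k) => [|[|k']] /=; rewrite ?mxE; [by []|by ring|].
  by case: a {fa} => [i|i j|i|i j]; try case: ifP => _; rewrite ?mxE; ring.
apply/rowP => k; rewrite !mxE.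
have E r : (r < d)%N -> enc p s 0 (inord r) = coords p s r.
  by move=> lt_r; rewrite mxE inordK.
case: k => [[|[|k]] lt_k] /=; rewrite ?E //= ?mulr1 //.
case: a fa => [i|i j|i|i j] //=; rewrite /upd; case: eqVneq => // ki.
- by case/andP=> _ lt_j; rewrite E.
- by rewrite ki -PoszD addn1.
Qed.

(** This is the square of [x_r - b x_c], written linearly in [X = x^T x]. *)
Definition sq_dist (r c : nat) (b : int) (X : 'M[int]_d) : int :=
  X (inord r) (inord r) - 2 * b * X (inord r) (inord c)
  + b ^+ 2 * X (inord c) (inord c).

Lemma sq_dist_gram r c b p s : (r < d)%N -> (c < d)%N ->
  sq_dist r c b (gram (enc p s)) = (coords p s r - b * coords p s c) ^+ 2.
Proof.
move=> lt_r lt_c.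
have E i j : (i < d)%N -> (j < d)%N ->
    gram (enc p s) (inord i) (inord j) = coords p s i * coords p s j.
  by move=> lt_i lt_j; rewrite mxE big_ord1 !mxE !inordK.
by rewrite /sq_dist !E //; ring.
Qed.

Lemma sq_dist_linear r c b k X Y :
  sq_dist r c b (k *: X + Y) = k * sq_dist r c b X + sq_dist r c b Y.
Proof. by rewrite /sq_dist !mxE; ring. Qed.

Lemma sq_dist0 r c b : sq_dist r c b 0 = 0.
Proof. by rewrite /sq_dist !mxE; ring. Qed.

(** The first term tests the program counter, the second the guard; being squares on Gram matrices,
    they cannot cancel. *)
Definition cost (p : nat) (a : atom) (X : 'M[int]_d) : int :=
  sq_dist 1 0 p X + if a is Eq i j then sq_dist i.+2 j.+2 1 X else 0.

Lemma cost_linear p a k X Y : cost p a (k *: X + Y) = k * cost p a X + cost p a Y.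
Proof. by rewrite /cost; case: a => *; rewrite !sq_dist_linear; ring. Qed.

Lemma cost0 p a : cost p a 0 = 0.
Proof. by rewrite /cost; case: a => *; rewrite !sq_dist0. Qed.

Lemma cost_ge0 p q a s : fits a -> 0 <= cost p a (gram (enc q s)).
Proof.
rewrite /cost; case: a => [i|i j|i|i j] fa; rewrite !sq_dist_gram //;
  rewrite ?addr_ge0 ?sqr_ge0 //; by case/andP: fa.
Qed.

Lemma cost_eq0 p q a s : fits a ->
  (cost p a (gram (enc q s)) == 0) = (q == p) && guard a s.
Proof.
have dist0 : sq_dist 1 0 p (gram (enc q s)) = (q%:Z - p%:Z) ^+ 2.
  by rewrite sq_dist_gram //= mulr1.
rewrite /cost dist0; case: a => [i|i j|i|i j] fa /=;
  rewrite ?addr0 ?sqrf_eq0 ?subr_eq0 ?eqz_nat ?andbT //.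
case/andP: fa => lt_i lt_j; rewrite sq_dist_gram //= mul1r.
by rewrite paddr_eq0 ?sqr_ge0 // !sqrf_eq0 !subr_eq0 !eqz_nat.
Qed.

(** The state is updated even when a test fails; the failure is only remembered in the error entry.
    The congruence turns [x^T x] into the Gram matrix of the updated [x]. *)
Definition edge_letter (e : edge) :=
  letter (fun h X => (h + row4 (cost e.1.1 e.1.2 X) 0 0 0,
     (update_mx e.2 e.1.2)^T *m X *m update_mx e.2 e.1.2)).

Lemma cfg_edge h X e : cfg h X *m edge_letter e =
  cfg (h + row4 (cost e.1.1 e.1.2 X) 0 0 0)
      ((update_mx e.2 e.1.2)^T *m X *m update_mx e.2 e.1.2).
Proof.
apply: cfg_letter => c u v Y Z /=; congr (_, _).
  rewrite cost_linear scalerDr row4Z addrACA row4D; congr (_ + row4 _ _ _ _); ring.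
by rewrite mulmxDr mulmxDl -scalemxAr -scalemxAl.
Qed.

Lemma cfg_edge_gram b p s e : fits e.1.2 ->
  cfg (row4 b 0 0 0) (gram (enc p s)) *m edge_letter e =
  cfg (row4 (b + cost e.1.1 e.1.2 (gram (enc p s))) 0 0 0)
      (gram (enc e.2 (act e.1.2 s))).
Proof.
move=> fe; rewrite cfg_edge row4D !addr0; congr cfg.
by rewrite -(enc_update e.2 p s fe) /gram trmx_mul !mulmxA.
Qed.

(* The input enters through three coordinates [N^2, N, 1], which keeps the code of
   the start letter a simple function of [N]; this letter moves them into [x^T x]. *)
Definition loaded (h : 'rV[int]_4) : 'M[int]_d :=
  h 0 (inord 1) *: delta_mx (inord 2) (inord 2)
  + h 0 (inord 2) *: (delta_mx (inord 2) (inord 0) + delta_mx (inord 0) (inord 2))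
  + h 0 (inord 3) *: delta_mx (inord 0) (inord 0).

Definition load_letter :=
  letter (fun h X => (row4 (h 0 (inord 0)) 0 0 0, X + loaded h)).

(** Entries 1 to 3 are cleared, so a second loading adds nothing. *)
Lemma cfg_load a b c e X : cfg (row4 a b c e) X *m load_letter =
  cfg (row4 a 0 0 0) (X + loaded (row4 a b c e)).
Proof.
rewrite cfg_letter /= ?mxE ?inordK // => k u v Y Z; congr (_, _).
  by rewrite row4Z row4D !mxE !mulr0 !addr0.
rewrite /loaded; move: (delta_mx _ _) (delta_mx _ _ + _) (delta_mx _ _) => P Q T.
by apply/matrixP => i j; rewrite !mxE; ring.
Qed.

Lemma loaded0 a : loaded (row4 a 0 0 0) = 0.
Proof. by rewrite /loaded !mxE !inordK // !scale0r !addr0. Qed.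

Definition init_store (N : nat) : store := fun i => if i == 0%N then N else 0%N.

Lemma loaded_gram N : (0 < K)%N ->
  loaded (row4 1 (N%:Z ^+ 2) N%:Z 1) = gram (enc 0 (init_store N)).
Proof.
move=> K0; have lt2 : (2 < d)%N by [].
(* The initial vector is 1 at coordinate 0, [N] at coordinate 2, and 0 elsewhere. *)
apply/matrixP => i j; rewrite !mxE big_ord1 !mxE !inordK //.
rewrite -!val_eqE /= !inordK //.
by case: i => [[|[|[|i]]] lt_i]; case: j => [[|[|[|j]]] lt_j] /=; rewrite /init_store /=; ring.
Qed.

(* The error term starts at 1, and this letter replaces that 1, read off the entry
   [x_0 ^ 2 = 1], by the error of the test [pc = L]; since it also clears [x^T x], a
   second use changes nothing. *)
Definition final_letter (L : nat) :=
  letter (fun h X =>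
    (h + row4 (sq_dist 1 0 L X - X (inord 0) (inord 0)) 0 0 0, 0)).

Lemma cfg_final L h X : cfg h X *m final_letter L =
  cfg (h + row4 (sq_dist 1 0 L X - X (inord 0) (inord 0)) 0 0 0) 0.
Proof.
rewrite cfg_letter // => c u v Y Z; rewrite /= scaler0 addr0; congr (_, _).
rewrite sq_dist_linear !mxE scalerDr row4Z addrACA row4D.
by congr (_ + row4 _ _ _ _); ring.
Qed.

Lemma cfg_final_gram b p s L :
  cfg (row4 (1 + b) 0 0 0) (gram (enc p s)) *m final_letter L =
  cfg (row4 (b + (p%:Z - L%:Z) ^+ 2) 0 0 0) 0.
Proof.
rewrite cfg_final row4D !addr0 sq_dist_gram //= mulr1.
have -> : gram (enc p s) (inord 0) (inord 0) = 1.
  by rewrite mxE big_ord1 !mxE inordK //= mulr1.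
by congr (cfg (row4 _ _ _ _) _); ring.
Qed.

End Simulation.

(** * From acceptance to mortality *)

Definition atom_bound (a : atom) : nat :=
  match a with
  | Zero i | Succ i => i.+1
  | Copy i j | Eq i j => maxn i.+1 j.+1
  end.

Lemma fits_bound K a : (atom_bound a <= K)%N -> fits K a.
Proof. by case: a => [i|i j|i|i j] //=; rewrite geq_max. Qed.

Section Reduction.
Variables (es : seq edge) (L : nat).
(** The successor keeps register 0, which receives the input, among the encoded ones. *)
Let K := (\max_(e <- es) atom_bound e.1.2).+1.
Let d := K.+2.
Local Notation dim := (4 + d * d)%N.

Let fits_es e : e \in es -> fits K e.1.2.
Proof. move=> ee; apply/fits_bound/leqW.
exact: (leq_bigmax_seq (F := fun e : edge => atom_bound e.1.2)). Qed.

Definition start_cfg (N : nat) : 'rV[int]_dim := cfg (row4 1 (N%:Z ^+ 2) N%:Z 1) 0.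

Definition start_letter (N : nat) : 'M[int]_dim := start (start_cfg N).

Definition letters : seq 'M[int]_dim :=
  [:: 1%:M, load_letter K, final_letter K L & [seq edge_letter K e | e <- es]].

(** The letters of an accepting run, between the loading and the final letter, add no error, so the
    start row is annihilated. All rows of the start letter are multiples of it, hence the whole
    product vanishes. *)
Lemma accepted_mortal N t :
  iterates (step es) (0%N, init_store N) (L, t) ->
  exists2 l : seq 'M[int]_dim,
    {subset l <= start_letter N :: letters} & \prod_(X <- l) X = 0.
Proof.
move=> run.
have reach y : iterates (step es) (0%N, init_store N) y ->
    exists2 l, {subset l <= letters} &
    start_cfg N *m \prod_(X <- l) X = cfg (row4 1 0 0 0) (gram (enc K y.1 y.2)).
  elim=> [|[p s] [q u] _ [l lE wl] [a [/= pe ga ->]]].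
    exists [:: load_letter K] => [X|]; first by rewrite !inE => ->; rewrite orbT.
    by rewrite big_seq1 cfg_load add0r loaded_gram.
  exists (rcons l (edge_letter K (p, a, q))) => [X|].
    rewrite mem_rcons inE => /orP[/eqP->|/lE //].
    by rewrite !inE map_f ?orbT.
  rewrite prod_mx_rcons mulmxA wl cfg_edge_gram ?(fits_es pe) //=.
  by have /eqP -> : cost p a (gram (enc K p s)) == 0;
    rewrite ?addr0 // cost_eq0 ?eqxx // (fits_es pe).
have [l lE wl] := reach _ run.
exists (start_letter N :: rcons l (final_letter K L)) => [X|].
  rewrite !inE mem_rcons inE => /or3P[->//|->|/lE]; first by rewrite !orbT.
  by rewrite !inE => ->; rewrite orbT.
rewrite big_cons prod_mx_rcons -[_ * _]/(_ *m _) /start_letter /start -mulmxA.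
set w := start_cfg N in wl *.
have -> : w *m (\prod_(X <- l) X *m final_letter K L) = 0.
  rewrite mulmxA wl -[1]addr0 cfg_final_gram subrr expr0n addr0.
  by rewrite row4_0 cfg0.
by rewrite mulmx0.
Qed.

(* The rows obtained from the start row: before loading, during the simulation
   (with total squared error [b]), and after the final letter. *)
Inductive legal N : 'rV[int]_dim -> Prop :=
  | LegalStart : legal N (start_cfg N)
  | LegalRun (b : int) p s of 0 <= b &
      (b = 0 -> iterates (step es) (0%N, init_store N) (p, s)) :
      legal N (cfg (row4 (1 + b) 0 0 0) (gram (enc K p s)))
  | LegalEnd (b : int) of 0 < b : legal N (cfg (row4 b 0 0 0) 0).

Lemma legal00 N y : legal N y -> y 0 0 != 0.
Proof.
case=> [|b p s b0 _|b b0]; rewrite cfg00 //; last by rewrite gt_eqF.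
by rewrite gt_eqF // ltr_wpDr.
Qed.

(** Errors only accumulate, and an error-free row comes from a genuine run. Letters played out of
    order do no harm: while [X] is 0, edge letters and the final letter change nothing. *)
Lemma legal_step N y X :
  ~ (exists t, iterates (step es) (0%N, init_store N) (L, t)) ->
  legal N y -> X \in letters -> legal N (y *m X).
Proof.
move=> rej Hy; rewrite !inE => /or4P[/eqP->|/eqP->|/eqP->|/mapP[e ee ->]].
- by rewrite mulmx1.
- case: Hy => [|b p s b0 run|b b0]; rewrite cfg_load.
  + rewrite add0r loaded_gram // -[1]addr0; apply: LegalRun => // _.
    exact: iterates_refl.
  + by rewrite (_ : loaded _ _ = 0) ?addr0 ?loaded0 //; apply: LegalRun.
  + by rewrite (_ : loaded _ _ = 0) ?addr0 ?loaded0 //; apply: LegalEnd.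
- case: Hy => [|b p s b0 run|b b0].
  + rewrite cfg_final sq_dist0 mxE subr0 row4D !addr0; exact: LegalStart.
  + rewrite cfg_final_gram; apply: LegalEnd; rewrite lt_neqAle addr_ge0 ?sqr_ge0 // andbT.
    (* Zero total error would mean a genuine run ending at [L]. *)
    rewrite eq_sym paddr_eq0 ?sqr_ge0 //; apply/negP => /andP[/eqP/run it].
    rewrite sqrf_eq0 subr_eq0 eqz_nat => /eqP pL; apply: rej; exists s.
    by rewrite -pL.
  + rewrite cfg_final sq_dist0 mxE subr0 row4D !addr0; exact: LegalEnd.
- case: Hy => [|b p s b0 run|b b0].
  + rewrite cfg_edge cost0 mulmx0 mul0mx row4D !addr0; exact: LegalStart.
  + have fe := fits_es ee; rewrite cfg_edge_gram // -addrA.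
    apply: LegalRun; first by rewrite addr_ge0 ?cost_ge0.
    move/eqP; rewrite paddr_eq0 ?cost_ge0 // cost_eq0 // => /and3P[/eqP/run it /eqP pe ge].
    apply: iterates_step it _; exists e.1.2; split=> //.
    by rewrite /= pe; case: e {fe ge pe} ee => [[]].
  + rewrite cfg_edge cost0 mulmx0 mul0mx row4D !addr0; exact: LegalEnd.
Qed.

(** The start row is followed through the product: it stays a nonzero multiple of a legal row, since
    playing the start letter again only multiplies by a nonzero error entry. *)
Lemma rejected_immortal N :
  ~ (exists t, iterates (step es) (0%N, init_store N) (L, t)) ->
  forall l : seq 'M[int]_dim,
    {subset l <= start_letter N :: letters} -> \prod_(X <- l) X != 0.
Proof.
move=> rej l lA.
have [c [y [c0 ly wl]]] : exists c y,
    [/\ c != 0, legal N y & start_cfg N *m \prod_(X <- l) X = c *: y].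
  elim/last_ind: l lA => [_|l X IH lA].
    by exists 1, (start_cfg N); split; rewrite ?big_nil ?mulmx1 ?scale1r //; constructor.
  have [Y Yl|c [y [c0 ly wl]]] := IH; first by apply: lA; rewrite mem_rcons inE Yl orbT.
  have := lA X; rewrite mem_rcons inE eqxx => /(_ isT).
  rewrite prod_mx_rcons mulmxA wl -scalemxAl inE => /orP[/eqP->|XL].
    exists (c * y 0 0), (start_cfg N); rewrite mul_start scalerA.
    by rewrite mulf_neq0 ?(legal00 ly) //; split=> //; constructor.
  by exists c, (y *m X); split=> //; apply: legal_step.
apply/eqP => l0; have := mulf_neq0 c0 (legal00 ly).
by move/matrixP/(_ 0 0): wl; rewrite l0 mulmx0 !mxE => <-; rewrite eqxx.
Qed.

Lemma start_letterE N i j : start_letter N i j =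
  if i == 0%N :> nat then nth 0 [:: 1; N%:Z ^+ 2; N%:Z; 1] j else 0.
Proof.
rewrite mxE big_ord1 mxE -val_eqE /= eqxx andbT.
case: eqP => _; last by rewrite mul0r.
rewrite mul1r /start_cfg /cfg linear0 mxE; case: splitP => k ->; rewrite mxE //.
by rewrite nth_default // leq_addr.
Qed.

Lemma code_start_letter : exists z, forall N,
  code_mx (start_letter N) =
  pcons 2 (pcons (N ^ 2).*2 (pcons N.*2 (pcons 2 z))).
Proof.
pose F N (i j : nat) :=
  code_int (if i == 0%N then nth 0 [:: 1; N%:Z ^+ 2; N%:Z; 1] j else 0).
have codeE N : code_mx (start_letter N) =
    CodeSeq.code [seq F N i j | i <- iota 0 dim, j <- iota 0 dim].
  rewrite -val_enum_ord allpairs_mapl allpairs_mapr /code_mx.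
  by congr CodeSeq.code; apply: eq_allpairs => i j; rewrite start_letterE.
(* Past the first four entries of row 0 nothing depends on [N], so the tail can be coded at [N = 0].
   The heads 2 in the formula are the codes of the integer 1. *)
pose tl N := [seq F N 0%N j | j <- iota 4 (d * d)] ++
  [seq F N i j | i <- iota 1 (3 + d * d), j <- iota 0 dim].
have tlE N : tl N = tl 0%N.
  congr (_ ++ _).
    apply/eq_in_map => j; rewrite mem_iota => /andP[j4 _].
    by rewrite /F !nth_default.
  apply/eq_in_allpairs => i j; rewrite mem_iota => /andP[i0 _] _.
  by rewrite /F gtn_eqF.
exists (CodeSeq.code (tl 0%N)) => N.
by rewrite codeE -(tlE N) -!code_cons; congr CodeSeq.code.
Qed.

End Reduction.

(** [D], [z] and [T] are fixed before [N]; this lets [N] be chosen as a code of them. *)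
Lemma mortality_reduction (es : seq edge) (L : nat) :
  exists (D z : nat) (S : nat -> 'M[int]_D) (T : seq 'M[int]_D),
  [/\ (0 < D)%N, 1%:M \in T,
      forall N, code_mx (S N) = pcons 2 (pcons (N ^ 2).*2 (pcons N.*2 (pcons 2 z))) &
      forall N,
        ((exists t, iterates (step es) (0%N, init_store N) (L, t)) ->
         exists2 l : seq 'M[int]_D, {subset l <= S N :: T} & \prod_(X <- l) X = 0) /\
        (~ (exists t, iterates (step es) (0%N, init_store N) (L, t)) ->
         forall l : seq 'M[int]_D, {subset l <= S N :: T} -> \prod_(X <- l) X != 0)].
Proof.
have [z zP] := code_start_letter es.
exists _, z, (start_letter es), (letters es L); split=> // [|N].
  by rewrite inE eqxx.
split; last exact: rejected_immortal.
by case=> t; apply: accepted_mortal.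
Qed.

(** * Values of one-player games *)

Section GameValues.
Local Open Scope classical_set_scope.

Lemma limn_esup_ge (R : realType) (u : (\bar R)^nat) (c : \bar R) :
  (forall n, (c <= u n)%E) -> (c <= limn_esup u)%E.
Proof.
move=> cu; rewrite limn_esup_lim; apply: lime_ge; first exact: is_cvg_esups.
near=> n; apply: le_trans (cu n) _.
by apply: ereal_sup_ubound; exists n => /=.
Unshelve. all: by end_near. Qed.

Section Game.
Context {R : realType} {m n : nat}.
Variables (A : set 'M[R]_(m, n)) (E : set 'M[R]_(n, m)).

(** The bound on all payoffs makes both values at least [V], and [sigma0] makes both at most [V];
    [tau0] keeps the suprema over Eve's strategies from being empty. *)
Lemma determined_by_adam (V : R) (sigma0 : adam_strategy A E) (tau0 : eve_strategy A E) :
  (forall (sigma : adam_strategy A E) tau, (V%:E <= payoff sigma tau)%E) ->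
  (forall tau : eve_strategy A E, payoff sigma0 tau = V%:E) ->
  determined_with_value A E V.
Proof.
move=> lo eq0; split; apply/eqP; rewrite eq_le; apply/andP; split.
- apply: le_trans (ereal_inf_lbound _) _.
    by exists sigma0.
  by apply: ge_ereal_sup => _ [tau _ <-]; rewrite eq0.
- apply: le_ereal_inf_tmp => _ [sigma _ <-].
  by apply: le_trans (lo sigma tau0) _; apply: ereal_sup_ubound; exists tau0.
- apply: ge_ereal_sup => _ [tau _ <-]; rewrite -(eq0 tau).
  by apply: ereal_inf_lbound; exists sigma0.
- apply: le_trans (ereal_sup_ubound _); last by exists tau0.
  by apply: le_ereal_inf_tmp => _ [sigma _ <-]; apply: lo.
Qed.

End Game.

(** * The norm of integer matrices *)

Section Norm.
Context {R : realType}.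

Lemma norm1_ge0 p q (X : 'M[R]_(p, q)) : 0 <= norm1 X.
Proof. by apply: bigmax_ge_id. Qed.

Lemma norm1_0 p q : norm1 (0 : 'M[R]_(p, q)) = 0.
Proof.
apply: (big_ind (fun x : R => x = 0)) => // [x y -> ->|j _]; first by rewrite maxxx.
by rewrite big1 // => i _; rewrite mxE normr0.
Qed.

Lemma norm1_1 D : (0 < D)%N -> norm1 (1%:M : 'M[R]_D) = 1.
Proof.
move=> D0; have col (j : 'I_D) : \sum_(i < D) `|(1%:M : 'M[R]_D) i j| = 1.
  rewrite (bigD1 j) //= mxE eqxx normr1 big1 ?addr0 // => i /negPf ij.
  by rewrite mxE ij normr0.
apply/eqP; rewrite eq_le; apply/andP; split.
  by apply: bigmax_le => // j _; rewrite col.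
by rewrite -[leLHS](col (Ordinal D0)); apply: le_bigmax.
Qed.

Lemma norm1_int_ge1 p q (X : 'M[int]_(p, q)) : X != 0 ->
  1 <= norm1 (map_mx intr X : 'M[R]_(p, q)).
Proof.
move=> X0; have [i [j Xij]] : exists i j, X i j != 0.
  apply: contrapT => H; move/eqP: X0; apply; apply/matrixP => i j; rewrite mxE.
  by apply/eqP; apply: contrapT => /negP Xij; apply: H; exists i, j.
apply: le_trans (le_bigmax _ _ j).
rewrite (bigD1 i) //= mxE; apply: ler_wpDr; first exact: sumr_ge0.
by rewrite -intr_norm ler1z -gtz0_ge1 normr_gt0.
Qed.

End Norm.

(** * Games in which Eve can only play the identity *)

Section Mortality.
Context {R : realType} {D : nat}.
Variable A : seq 'M[int]_D.
Hypotheses (D_gt0 : (0 < D)%N) (A1 : 1%:M \in A).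

Let setA := real_mxset R A.
Let setE := real_mxset R [:: 1%:M : 'M[int]_D].

Let mem_real (s : seq 'M[int]_D) X : X \in s -> map_mx intr X \in real_mxset R s.
Proof. by move=> Xs; rewrite inE; exists X. Qed.

Let real_elt (s : seq 'M[int]_D) X (Xs : X \in s) : real_mxset R s :=
  exist (fun Y => Y \in real_mxset R s) _ (mem_real Xs).

Let eve (h : history setA setE) (a : setA) : setE :=
  real_elt (mem_head 1%:M [::]).

(** The size of the history is the number of rounds played. After the end of [l], the default of
    [nth] makes Adam play the identity. *)
Let adam (l : seq 'M[int]_D) (h : history setA setE) : setA :=
  insubd (real_elt A1) (map_mx intr (nth 1%:M l (size h)) : 'M[R]_D).

Let eveE (e : setE) : \val e = 1%:M.
Proof.
by have := valP e; rewrite inE => -[X /=]; rewrite inE => /eqP -> <-; rewrite map_mx1.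
Qed.

Let history_product_rcons (h : history setA setE) r :
  history_product (rcons h r) = history_product h *m \val r.1.
Proof. by rewrite /history_product big_rcons /= eveE mulmx1. Qed.

Let history_product_int (h : history setA setE) : exists l : seq 'M[int]_D,
  {subset l <= A} /\ history_product h = map_mx intr (\prod_(X <- l) X).
Proof.
elim/last_ind: h => [|h r [l [lA hl]]].
  by exists [::]; rewrite /history_product !big_nil map_mx1.
have := valP r.1; rewrite inE => -[X /= XA Xr].
exists (rcons l X); split=> [Y|].
  by rewrite mem_rcons inE => /orP[/eqP->|/lA].
by rewrite history_product_rcons hl big_rcons /= map_mxM Xr.
Qed.

Let size_play (sigma : adam_strategy setA setE) tau k : size (play sigma tau k) = k.
Proof. by elim: k => //= k IH; rewrite size_rcons IH. Qed.

Let play_adam l tau k : {subset l <= A} ->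
  history_product (play (adam l) tau k) = map_mx intr (\prod_(X <- take k l) X).
Proof.
move=> lA; elim: k => [|k IH]; first by rewrite take0 /history_product !big_nil map_mx1.
rewrite /= history_product_rcons IH /= /adam size_play val_insubd.
have -> : map_mx intr (nth 1%:M l k) \in setA.
  apply: mem_real; case: (ltnP k (size l)) => [kl|lk]; last by rewrite nth_default.
  exact/lA/mem_nth.
rewrite -map_mxM; congr map_mx; case: (ltnP k (size l)) => [kl|lk].
  by rewrite (take_nth 1%:M) // big_rcons.
by rewrite nth_default // !take_oversize ?mulmx1 // leqW.
Qed.

Lemma determined_mortal (l : seq 'M[int]_D) :
  {subset l <= A} -> \prod_(X <- l) X = 0 -> determined_with_value setA setE 0.
Proof.
move=> lA l0; apply: (determined_by_adam (sigma0 := adam l) eve).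
  by move=> sigma tau; apply: limn_esup_ge => k; rewrite lee_fin powR_ge0.
move=> tau; rewrite /payoff.
set u := fun k : nat => _.
have u0 : u @ \oo --> 0%:E.
  (* From index [size l] on the product is 0, and 0 raised to the nonzero exponent [1 / k.+1] is
     0. *)
  apply: cvg_near_cst; exists (size l) => // k /= lk.
  rewrite /u play_adam // take_oversize; last exact: leqW.
  by rewrite l0 map_mx0 norm1_0 powR0 // invr_neq0.
by rewrite is_cvg_limn_esupE ?(cvg_lim _ u0) //; apply: cvgP u0.
Qed.

(** Nonzero integer products have norm at least 1, and so have the roots of these norms; playing the
    identity forever attains 1. *)
Lemma determined_immortal :
  (forall l : seq 'M[int]_D, {subset l <= A} -> \prod_(X <- l) X != 0) ->
  determined_with_value setA setE 1.
Proof.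
move=> nz; apply: (determined_by_adam (sigma0 := adam [::]) eve).
  move=> sigma tau; apply: limn_esup_ge => k; rewrite lee_fin.
  have [l [/nz l0 ->]] := history_product_int (play sigma tau k.+1).
  apply: le_trans (ge0_ler_powR _ _ _ (norm1_int_ge1 l0));
    by rewrite ?powR1 ?nnegrE ?norm1_ge0.
move=> tau; rewrite /payoff.
set u := fun k : nat => _.
have u1 : u @ \oo --> 1%:E.
  apply: cvg_near_cst; apply: nearW => k.
  by rewrite /u play_adam // big_nil map_mx1 norm1_1 // powR1.
by rewrite is_cvg_limn_esupE ?(cvg_lim _ u1) //; apply: cvgP u1.
Qed.

End Mortality.

End GameValues.

(** * Diagonalization *)

Lemma computable_nth n i : computable (fun v : n.-tuple nat => nth 0%N v i).
Proof.
case: (ltnP i n) => [lt_in|le_ni].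
  apply: computable_ext (computable_proj (Ordinal lt_in)) => v.
  by rewrite (tnth_nth 0%N).
apply: computable_ext (computable_const n 0) => v.
by rewrite nth_default ?size_tuple.
Qed.

Lemma recognizable_comp p n (f : recfun p) (G : 'I_p -> n.-tuple nat -> nat) Y :
  (forall i, computable (G i)) -> computable Y ->
  recognizable (fun v => rec_eval f [tuple G i v | i < p] (Y v)).
Proof.
move=> /choice[g gG] cY.
apply: recognizable_ext (recognizable_eval (RecComp f g) cY) => v /=; split.
  case=> w gw; have -> // : w = [tuple G i v | i < p].
  apply: eq_from_tnth => i; rewrite tnth_mktuple.
  exact: rec_eval_functional (gw i) (gG i v).
by move=> fw; exists [tuple G i v | i < p] => // i; rewrite tnth_mktuple.
Qed.

(* Composition with computable functions is built in to let [Q] be used in any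
   number of variables. *)
Definition listable (Q : nat -> Prop) :=
  forall n (H : n.-tuple nat -> nat), computable H -> recognizable (fun v => Q (H v)).

(* The code of the game [(S N :: T, [:: 1])] of dimension [D], where [z] codes the
   part of [S N] not depending on [N] and [cA], [cE] code [T] and [[:: 1]]. *)
Definition game_code_at (N D z cA cE : nat) : nat :=
  pcons D (pcons D (pcons (pcons
    (pcons 2 (pcons (N ^ 2).*2 (pcons N.*2 (pcons 2 z)))) cA) (pcons cE 0))).

(** On input [N] the program guesses four numbers with code [N], unique by injectivity of the
    coding, and tests [Q] on the game code formed from them and [N] itself. The game thus gets a
    description of itself as input. *)
Lemma self_application (Q : nat -> Prop) : listable Q ->
  exists c : cmd, forall D z cA cE,
    let N := CodeSeq.code [:: D; z; cA; cE] in
    (exists t, exec c (init_store N) t) <-> Q (game_code_at N D z cA cE).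
Proof.
move=> lQ.
pose x i (v : 5.-tuple nat) := nth 0%N v i.
have cx i : computable (x i) by apply: computable_nth.
have cpack : computable (fun v => CodeSeq.code [:: x 1%N v; x 2%N v; x 3%N v; x 4%N v]).
  by do 4?[apply: computable_pcons => //]; apply: computable_const.
have ccode : computable (fun v =>
    game_code_at (x 0%N v) (x 1%N v) (x 2%N v) (x 3%N v) (x 4%N v)).
  have c0 k := computable_const 5 k.
  do 3![apply: computable_pcons => //]; last exact: computable_pcons.
  apply: computable_pcons => //; apply: computable_pcons => //.
  apply: computable_pcons.
    by apply: computable_double; rewrite /expn /=; apply: computable_mul.
  by apply: computable_pcons; [apply: computable_double | apply: computable_pcons].
have [c cP] := recognizable_ex (recognizable_ex (recognizable_ex (recognizable_ex
  (recognizable_and (recognizable_eq cpack (cx 0%N)) (lQ _ _ ccode))))).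
exists c => D z cA cE N; rewrite -(proj1 (cP (init_store N))).
have -> : env 1 (init_store N) = [tuple N].
  by apply: eq_from_tnth => i; rewrite tnth_mktuple !ord1.
split=> [[a [b [e [g [eN]]]]]|QN]; last by exists D, z, cA, cE.
have {eN} : CodeSeq.code [:: a; b; e; g] = CodeSeq.code [:: D; z; cA; cE] := eN.
by case/(can_inj CodeSeq.codeK) => <- <- <- <-.
Qed.

(** Acceptance of [N] amounts to [Q] on the game built from the program, but gives this game the
    value 0, where [Q] must fail; rejection gives the value 1, where [Q] must hold. *)
Lemma no_listable_separation (R : realType) (Q : nat -> Prop) : listable Q ->
  ~ forall (D : nat) (A E : seq 'M[int]_D), (0 < D)%N -> A <> [::] -> E <> [::] ->
      (determined_with_value (real_mxset R A) (real_mxset R E) 0 ->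
         ~ Q (code_game A E)) /\
      (determined_with_value (real_mxset R A) (real_mxset R E) 1 ->
         Q (code_game A E)).
Proof.
move=> /self_application[c cQ] sep.
set es := edges c 0; set L := cmd_size c.
have [D [z [S [T [D0 T1 codeS redS]]]]] := mortality_reduction es L.
have run N : (exists t, exec c (init_store N) t) <->
    exists t, iterates (step es) (0%N, init_store N) (L, t).
  split=> -[t ct]; exists t; first by have := edges_of_exec 0 ct; rewrite add0n.
  by apply: (exec_of_edges (b := 0)); rewrite add0n.
pose E : seq 'M[int]_D := [:: 1%:M].
pose N := CodeSeq.code [:: D; z; code_mxs T; code_mxs E].
have accN := cQ D z (code_mxs T) (code_mxs E); rewrite -/N in accN.
have codeE : code_game (S N :: T) E = game_code_at N D z (code_mxs T) (code_mxs E).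
  by rewrite /game_code_at -codeS.
have A1 : 1%:M \in S N :: T by rewrite inE T1 orbT.
have [mortal immortal] := redS N.
have [det0 det1] := sep D (S N :: T) E D0 ltac:(by []) ltac:(by []).
rewrite codeE in det0 det1.
have nacc : ~ exists t, exec c (init_store N) t.
  move=> acc; have [l lA l0] := mortal (proj1 (run N) acc).
  by apply: det0; [apply: determined_mortal lA l0 | apply/accN].
apply: (nacc); apply/accN/det1/determined_immortal => //.
by apply: immortal => /run.
Qed.

(** * Listable predicates from a purported algorithm *)

Lemma listable_eval (f : recfun 1) (y : nat) : listable (fun x => rec_eval f [tuple x] y).
Proof.
move=> n H cH.
apply: recognizable_ext
  (recognizable_comp f (G := fun=> H) (fun=> cH) (computable_const n y)) => v.
by rewrite (_ : [tuple H v | _ < 1] = [tuple H v]) //;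
  apply: eq_from_tnth => i; rewrite tnth_mktuple !ord1.
Qed.

(* For a fraction with code [code [:: 2k; 2r]], being at least 1/2 means [r <= 2k]. *)
Lemma listable_approx (f : recfun 2) (e : nat) :
  listable (fun x => exists k r t,
    rec_eval f [tuple x; e] (CodeSeq.code [:: k.*2; r.*2]) /\ k.*2 = (r + t)%N).
Proof.
move=> n H cH; pose x i (v : n.+3.-tuple nat) := nth 0%N v i.
have cx i : computable (x i) by apply: computable_nth.
pose H' (v : n.+3.-tuple nat) := H [tuple x i v | i < n].
have cH' : computable H' by apply: (computable_comp cH) => i; apply: cx.
pose G (i : 'I_2) := if i == 0 then H' else fun=> e.
have cG i : computable (G i).
  by rewrite /G; case: eqP => // _; apply: computable_const.
have cY : computable (fun v => CodeSeq.code [:: (x n v).*2; (x n.+1 v).*2]).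
  apply: computable_pcons; first exact: computable_double.
  apply: computable_pcons; [exact: computable_double | exact: computable_const].
have := recognizable_ex (recognizable_ex (recognizable_ex
  (recognizable_and (recognizable_comp f cG cY)
     (recognizable_eq (computable_double (cx n)) (computable_add (cx n.+1) (cx n.+2)))))).
apply: recognizable_ext => v.
(* The quantified variables sit at positions [n], [n.+1] and [n.+2], after the original ones. *)
have sem k r t (w := [tuple of rcons [tuple of rcons [tuple of rcons v k] r] t]) :
    [/\ x n w = k, x n.+1 w = r, x n.+2 w = t & [tuple G i w | i < 2] = [tuple H v; e]].
  have H'w : H' w = H v.
    congr H; apply: eq_from_tnth => i; rewrite tnth_mktuple /x /= !nth_rcons.
    rewrite !size_rcons size_tuple (tnth_nth 0%N).
    by have := ltn_ord i; rewrite !ltnS => lt_i; rewrite !ifT //; lia.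
  split; rewrite /x /= ?nth_rcons ?size_rcons ?size_tuple ?ltnSn ?ltnn ?eqxx ?leqnSn //.
  by apply: eq_from_tnth => i; rewrite tnth_mktuple /G;
    case: i => [[|[|i]] lt_i]; rewrite ?H'w.
split=> -[k [r [t]]]; have [ek er et eG] := sem k r t => krt; exists k, r, t.
  by move: krt; rewrite eG ek er et.
by rewrite eG ek er et.
Qed.

Unset Implicit Arguments.

Theorem theorem5 (R : realType) :
  (~ exists f : recfun 2,
      forall (m n : nat) (A : seq 'M[int]_(m, n)) (E : seq 'M[int]_(n, m))
             (V : R) (eps : rat),
        (0 < m)%N -> (0 < n)%N -> A <> [::] -> E <> [::] ->
        determined_with_value (real_mxset R A) (real_mxset R E) V ->
        0 < eps ->
        exists2 q : rat,
          rec_eval f [tuple code_game A E; code_rat eps] (code_rat q)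
          & `|ratr q - V| <= ratr eps)
  /\
  (~ exists f : recfun 1,
      forall (m n : nat) (A : seq 'M[int]_(m, n)) (E : seq 'M[int]_(n, m))
             (V : nat),
        (0 < m)%N -> (0 < n)%N -> A <> [::] -> E <> [::] ->
        V = 0%N \/ V = 1%N ->
        determined_with_value (real_mxset R A) (real_mxset R E) V%:R ->
        rec_eval f [tuple code_game A E] V).
Proof.
split=> -[f fP]; last first.
  (* The predicate is that the algorithm outputs 1; at value 0 it outputs 0, and outputs are
     unique. *)
  apply: (no_listable_separation (R := R) (listable_eval f 1)) => D A E D0 A0 E0.
  split=> det.
    by move=> /(rec_eval_functional (fP _ _ _ _ 0%N D0 D0 A0 E0 (or_introl erefl) det)).
  exact: (fP _ _ _ _ 1%N D0 D0 A0 E0 (or_intror erefl) det).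
(* Approximations within 1/3 are at most 1/3 for value 0 and at least 2/3 for value 1, so the
   threshold 1/2 separates them. *)
pose eps : rat := 3^-1.
apply: (no_listable_separation (R := R) (listable_approx f (code_rat eps))) => D A E D0 A0 E0.
(* Multiplying the error bound by [3 * denq q] leaves inequalities between integers when [V] is 0 or
   1. *)
have approx V : determined_with_value (real_mxset R A) (real_mxset R E) V ->
    exists q, [/\ rec_eval f [tuple code_game A E; code_rat eps] (code_rat q),
      3 * V * (denq q)%:~R - (denq q)%:~R <= 3 * (numq q)%:~R :> R &
      3 * (numq q)%:~R <= 3 * V * (denq q)%:~R + (denq q)%:~R :> R].
  move=> det; have eps0 : 0 < eps by [].
  have [q fq] := fP _ _ _ _ V eps D0 D0 A0 E0 det eps0.
  rewrite /eps fmorphV /= ratr_nat /ratr => qV; exists q.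
  have d0 : 0 < (denq q)%:~R :> R by rewrite ltr0z denq_gt0.
  move: qV d0; set a : R := (numq q)%:~R; set b : R := (denq q)%:~R => qV b0.
  have -> : a = a / b * b by rewrite divfK // gt_eqF.
  move: qV; move: (a / b) => x; rewrite ler_norml => /andP[lo hi].
  split=> //; rewrite -subr_ge0.
    have -> : 3 * (x * b) - (3 * V * b - b) = 3 * (x - V + 3^-1) * b by field.
    by rewrite !mulr_ge0 ?(ltW b0) // -lerBlDr sub0r.
  have -> : 3 * V * b + b - 3 * (x * b) = 3 * (3^-1 - (x - V)) * b by field.
  by rewrite !mulr_ge0 ?(ltW b0) // subr_ge0.
have three : 3 = 3%:~R :> R by [].
split=> /approx[q [fq lo hi]]; have d0 := denq_gt0 q.
  (* Even codes belong to nonnegative integers, so [k] and [r] are the numerator and the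
     denominator; [3k <= r <= 2k] forces [r = 0]. *)
  case=> k [r [t [/(rec_eval_functional fq)/(can_inj CodeSeq.codeK)[ek er] krt]]].
  move: hi; rewrite mulr0 mul0r add0r three -intrM ler_int.
  by case: (numq q) (denq q) ek er d0 => [a|a] [b|b] /=; lia.
move: lo; rewrite mulr1 three -!intrM -intrB ler_int => lo.
(* Here [2r <= 3k], so the numerator is nonnegative and [r <= 2k]. *)
have [k ek] : exists k : nat, numq q = k by exists `|numq q|%N; lia.
have [r er] : exists r : nat, denq q = r by exists `|denq q|%N; lia.
exists k, r, (k.*2 - r)%N; split; last by lia.
by move: fq; rewrite /code_rat ek er.
Qed.
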